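(* Fix $X\in\mathbb R^{n\times p}$ and $\mathbf y\in\mathbb R^n$ such that $X^{\top}X$ is invertible. Fix $\eta\in(0,1)$ and $\nu\in(0,1/e)$. Let $\widetilde{X^{\top}X}=X^{\top}X+N$ and $\widetilde{X^{\top}\mathbf y}=X^{\top}\mathbf y+\mathbf n$, where each entry of the $p\times p$ matrix $N$ and of the vector $\mathbf n\in\mathbb R^p$ is sampled i.i.d. from $\mathcal N(0,\sigma^2)$. Let $\hat{\boldsymbol\beta}=(X^{\top}X)^{-1}X^{\top}\mathbf y$ and $\tilde{\boldsymbol\beta}=(\widetilde{X^{\top}X})^{-1}\widetilde{X^{\top}\mathbf y}$. Then there exists a constant $C\ge1$ such that if $\sigma_{\min}(X^{\top}X)\ge\frac{2C}{\eta}\cdot\sigma\sqrt p\log(1/\nu)$, then with probability at least $1-\nu$, \[ \left\|\tilde{\boldsymbol\beta}-\hat{\boldsymbol\beta}\right\|\le2\eta\|\hat{\boldsymbol\beta}\|+\frac{\eta}{C}. \]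
   Context: $\sigma_{\min}(M)$ denotes the least singular value of $M$; $\|\cdot\|$ is the Euclidean norm. *)

(* Defs.v *)
From HB Require Import structures.
From mathcomp Require Import all_boot all_order all_algebra.
From mathcomp Require Import all_classical all_reals all_analysis.
Set Implicit Arguments. Unset Strict Implicit. Unset Printing Implicit Defensive.
Import Order.TTheory GRing.Theory Num.Theory.
Local Open Scope classical_set_scope.
Local Open Scope ring_scope.

Definition vnorm {R : realType} {p : nat} (v : 'cV[R]_p) : R :=
  Num.sqrt (\sum_(i < p) v i ord0 ^+ 2).

Definition sigma_min {R : realType} {p : nat} (M : 'M[R]_p) : R :=
  inf [set vnorm (M *m v) | v in [set v : 'cV[R]_p | vnorm v = 1]].

Definition mutually_independent {d} {T : measurableType d} {R : realType}
  (P : probability T R) (I : finType) (g : I -> T -> R) : Prop :=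
  forall B : I -> set R, (forall i, measurable (B i)) ->
    P (\bigcap_i (g i @^-1` B i)) = (\prod_(i : I) P (g i @^-1` B i))%E.

(* g is a family of i.i.d. N(0, s^2) random variables
   (normal_prob m s has mean m and standard deviation s). *)
Definition iid_gaussian {d} {T : measurableType d} {R : realType}
  (P : probability T R) (I : finType) (g : I -> T -> R) (s : R) : Prop :=
  [/\ forall i, measurable_fun setT (g i),
      forall i (B : set R), measurable B -> P (g i @^-1` B) = normal_prob 0 s B
    & mutually_independent P g].

Definition noise_family {T : Type} {R : realType} {p : nat}
  (Nf : 'I_p -> 'I_p -> T -> R) (nf : 'I_p -> T -> R) :
  ('I_p * 'I_p + 'I_p)%type -> T -> R :=
  fun k => match k with inl ij => Nf ij.1 ij.2 | inr i => nf i end.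

(* Main.v *)
(** Write tau = sigma sqrt p log(1/nu), M = X^T X, b = beta_hat and S = sigma_min M.
   Since (M + N)(beta_tilde - b) = n - N b, a bound ||N|| <= 18 tau gives
   (S - 18 tau) ||beta_tilde - b|| <= ||n|| + 18 tau ||b||, and S >= 720 tau / eta
   (that is, C = 360) absorbs everything provided ||n|| <= 1.95 tau.  The factor
   in front of tau in the bound of ||n|| must stay below 2 whatever C is, as the
   additive error is only eta / C; hence the care taken with the tail of ||n||.

   The operator norm of N is controlled by the bilinear forms z^T N w with z, w
   in a net made of lattice points: there are at most exp(18 p) of them and each
   form has a Gaussian tail.  All tails come from the Chernoff method, which only
   needs E (prod_i F_i(g_i)) = prod_i E F_i(g_i) for nonnegative F_i. *)

Require Import Defs.
From HB Require Import structures.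
From mathcomp Require Import all_boot all_order all_algebra.
From mathcomp Require Import all_classical all_reals all_analysis.
From mathcomp Require Import finmap measurable_realfun ring lra.
Set Implicit Arguments.
Unset Strict Implicit.
Unset Printing Implicit Defensive.
Import Order.TTheory GRing.Theory Num.Theory.
Local Open Scope classical_set_scope.
Local Open Scope ring_scope.

Import HBNNSimple.

(** * Change of variables and Gaussian integrals *)

(** Linearity extends the identity from indicators to simple functions, and monotone convergence
    extends it to nonnegative measurable [f]. The weight [W] allows two uses: as a density, with [X]
    the identity, and as the product of the remaining factors in the induction of
    [iid_integral_prod]. *)
Lemma integral_weighted_comp d (T : measurableType d) d' (S : measurableType d')
    (R : realType) (mu : {measure set T -> \bar R})
    (m : {measure set S -> \bar R}) (X : T -> S) (W : T -> R) (c : R)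
    (f : S -> R) :
  measurable_fun setT X -> measurable_fun setT W -> (forall t, 0 <= W t) ->
  0 <= c ->
  (forall B, measurable B ->
     (\int[mu]_t (W t * \1_B (X t))%:E = c%:E * m B)%E) ->
  measurable_fun setT f -> (forall x, 0 <= f x) ->
  (\int[mu]_t (W t * f (X t))%:E = c%:E * \int[m]_x (f x)%:E)%E.
Proof.
move=> mX mW W0 c0 WB mf f0.
have mEf : measurable_fun setT (fun x => (f x)%:E) by exact/measurable_EFinP.
have mWX (h : S -> R) : measurable_fun setT h ->
    measurable_fun setT (fun t => W t * h (X t)).
  by move=> mh; apply: measurable_funM => //; exact: (measurableT_comp mh mX).
have simple (h : {nnsfun S >-> R}) :
    (\int[mu]_t (W t * h (X t))%:E = c%:E * \int[m]_x (h x)%:E)%E.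
  set s := fset_set (range h).
  have s0 (i : 'I_#|`s|) : 0 <= s`_i.
    have : s`_i \in s by exact: mem_nth.
    by rewrite in_fset_set// => /set_mem[x _ <-].
  have mA i : measurable (h @^-1` [set s`_i]) by exact: measurable_sfunP.
  transitivity (\int[mu]_t \sum_(i < #|`s|)
      ((s`_i)%:E * (W t * \1_(h @^-1` [set s`_i]) (X t))%:E))%E.
    apply: eq_integral => t _; rewrite fimfunEord mulr_sumr -sumEFin.
    by apply: eq_bigr => i _; rewrite mulrCA EFinM.
  transitivity (c%:E * \int[m]_x \sum_(i < #|`s|)
      ((s`_i)%:E * (\1_(h @^-1` [set s`_i]) x)%:E))%E; last first.
    congr (_ * _)%E; apply: eq_integral => x _; rewrite fimfunEord -sumEFin.
    by apply: eq_bigr => i _; rewrite EFinM.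
  rewrite !ge0_integral_sum//.
  - rewrite ge0_sume_distrr => [|i _]; last first.
      by apply: integral_ge0 => x _; rewrite -EFinM lee_fin mulr_ge0.
    apply: eq_bigr => i _; rewrite !ge0_integralZl_EFin//.
    + by rewrite WB// integral_indic// setIT muleCA.
    + by apply/measurable_EFinP; exact: measurable_indic.
    + by move=> t _; rewrite lee_fin mulr_ge0.
    + by apply/measurable_EFinP/mWX; exact: measurable_indic.
  - by move=> i; apply/measurable_EFinP; apply: measurable_funM.
  - by move=> i x _; rewrite -EFinM lee_fin mulr_ge0.
  - move=> i; apply/measurable_EFinP; apply: measurable_funM => //.
    by apply: mWX; exact: measurable_indic.
  - by move=> i x _; rewrite -EFinM lee_fin !mulr_ge0.
pose h := nnsfun_approx measurableT mEf.
have cvg_h x : (h n x)%:E @[n --> \oo] --> (f x)%:E.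
  by apply: (cvg_nnsfun_approx measurableT mEf) => // y _; rewrite lee_fin.
have nd_h x n k : (n <= k)%N -> h n x <= h k x.
  by move=> nk; exact/lefP/nd_nnsfun_approx.
transitivity (limn (fun n => \int[mu]_t (W t * h n (X t))%:E)%E).
  rewrite -monotone_convergence//=.
  - apply: eq_integral => t _; apply/esym/cvg_lim => //.
    under eq_fun do rewrite EFinM.
    by rewrite EFinM; apply: cvgeZl.
  - by move=> n; apply/measurable_EFinP/mWX.
  - by move=> n t _; rewrite lee_fin mulr_ge0.
  - by move=> t _ n k nk; rewrite lee_fin ler_wpM2l// nd_h.
under eq_fun do rewrite simple.
rewrite limeMl//; last first.
  apply/ereal_nondecreasing_is_cvgn => n k nk; apply: ge0_le_integral => //=.
  - by move=> x _; rewrite lee_fin.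
  - exact/measurable_EFinP.
  - exact/measurable_EFinP.
  - by move=> x _; rewrite lee_fin nd_h.
congr (_ * _)%E; rewrite -monotone_convergence//=.
- by apply: eq_integral => x _; apply/cvg_lim => //; exact: cvg_h.
- by move=> n; exact/measurable_EFinP.
- by move=> n x _; rewrite lee_fin.
- by move=> x _ n k nk; rewrite lee_fin nd_h.
Qed.

Lemma integral_normal_prob (R : realType) (m s : R) (f : R -> R) :
  measurable_fun setT f -> (forall x, 0 <= f x) ->
  (\int[normal_prob m s]_x (f x)%:E =
   \int[lebesgue_measure]_x (normal_pdf m s x * f x)%:E)%E.
Proof.
move=> mf f0; rewrite -[LHS]mul1e; apply/esym.
apply: (@integral_weighted_comp _ (measurableTypeR R) _ (measurableTypeR R) R
  lebesgue_measure (normal_prob m s) id (normal_pdf m s) 1 f) => //.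
- exact: measurable_normal_pdf.
- by move=> x; exact: normal_pdf_ge0.
- move=> B mB; rewrite mul1e /normal_prob [RHS]integral_mkcond.
  apply: eq_integral => x _; rewrite patchE indicE.
  by case: ifPn => _; rewrite ?mulr1 ?mulr0.
Qed.

(** Completing the square: the factor [expR (a * x)] moves the mean of the density from 0 to
    [a * s ^+ 2], up to the stated constant. *)
Lemma integral_normal_expR (R : realType) (s a : R) : 0 < s ->
  (\int[normal_prob 0 s]_x (expR (a * x))%:E =
   (expR (a ^+ 2 * s ^+ 2 / 2))%:E)%E.
Proof.
move=> s0; have sn0 : s != 0 by rewrite gt_eqF.
rewrite integral_normal_prob => [||x]; last 2 first.
- by apply: measurableT_comp => //; exact: measurable_funM.
- exact: expR_ge0.
transitivity (\int[lebesgue_measure]_x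
   ((expR (a ^+ 2 * s ^+ 2 / 2))%:E * (normal_pdf (a * s ^+ 2) s x)%:E)%E)%E.
  apply: eq_integral => x _; rewrite -EFinM !normal_pdfE//; congr EFin.
  rewrite /normal_fun /= -[LHS]mulrA -[in LHS]expRD [RHS]mulrCA -[in RHS]expRD; congr (_ * expR _).
  by field.
rewrite ge0_integralZl_EFin ?expR_ge0// ?integral_normal_pdf ?mule1//.
- by move=> x _; rewrite lee_fin normal_pdf_ge0.
- by apply/measurable_EFinP; exact: measurable_normal_pdf.
Qed.

(* [expR (3 x^2 / (8 s^2))] turns the density of N(0, s^2) into twice the
   density of N(0, 4 s^2). *)
Lemma integral_normal_expR_sqr (R : realType) (s : R) : 0 < s ->
  (\int[normal_prob 0 s]_x (expR (3 / (8 * s ^+ 2) * x ^+ 2))%:E = 2%:E)%E.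
Proof.
move=> s0; have sn0 : s != 0 by rewrite gt_eqF.
have s2n0 : 2 * s != 0 by rewrite gt_eqF// mulr_gt0.
rewrite integral_normal_prob => [||x]; last 2 first.
- apply: measurableT_comp => //; apply: measurable_funM => //.
- exact: expR_ge0.
transitivity (\int[lebesgue_measure]_x
   ((2 : R)%:E * (normal_pdf 0 (2 * s) x)%:E)%E)%E.
  apply: eq_integral => x _; rewrite -EFinM !normal_pdfE//; congr EFin.
  rewrite /normal_fun /= -[LHS]mulrA -[in LHS]expRD [RHS]mulrA; congr (_ * expR _).
    rewrite /normal_peak.
    have -> : (2 * s) ^+ 2 * pi *+ 2 = 2 ^+ 2 * (s ^+ 2 * pi *+ 2) :> R by ring.
    rewrite sqrtrM ?exprn_ge0// sqrtr_sqr ger0_norm// invfM mulrA divff ?mul1r//.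
  by field.
rewrite ge0_integralZl_EFin ?integral_normal_pdf ?mule1//.
- by move=> x _; rewrite lee_fin normal_pdf_ge0.
- by apply/measurable_EFinP; exact: measurable_normal_pdf.
Qed.

(** * Product formula and Chernoff bounds for i.i.d. Gaussian families *)

Section iid.
Context d (T : measurableType d) (R : realType) (P : probability T R).
Context (I : finType) (g : I -> T -> R) (s : R).
Hypothesis iid : iid_gaussian P g s.

(* Induction on the set of indices where [F i] is not yet an indicator
   function; for indicators the claim is mutual independence. *)
Lemma iid_integral_prod (F : I -> R -> R) (e : I -> R) :
  (forall i, measurable_fun setT (F i)) -> (forall i x, 0 <= F i x) ->
  (forall i, \int[normal_prob 0 s]_x (F i x)%:E = (e i)%:E)%E ->
  (\int[P]_t (\prod_i F i (g i t))%:E = (\prod_i e i)%:E)%E.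
Proof.
case: iid => mg lawg indg.
suff H (l : seq I) : forall (F : I -> R -> R) (e : I -> R),
    (forall i, i \notin l -> exists2 B, measurable B & F i = \1_B) ->
    (forall i, measurable_fun setT (F i)) -> (forall i x, 0 <= F i x) ->
    (forall i, \int[normal_prob 0 s]_x (F i x)%:E = (e i)%:E)%E ->
    (\int[P]_t (\prod_i F i (g i t))%:E = (\prod_i e i)%:E)%E.
  by move=> mF F0 Fe; apply: (H (enum I)) => // i; rewrite mem_enum.
elim: l => [|i0 l IH] {}F {}e Fl mF F0 Fe.
  have /choice[B BF] i : exists B, measurable B /\ F i = \1_B.
    by have [//|B mB ->] := Fl i; exists B.
  have mB i : measurable (B i) by case: (BF i).
  have mgB i : measurable (g i @^-1` B i).
    by rewrite -[X in measurable X]setTI; exact: mg.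
  transitivity (\int[P]_t (\1_(\bigcap_i (g i @^-1` B i)) t)%:E)%E.
    apply: eq_integral => t _; congr EFin; rewrite indicE.
    have [Bt|/negP Bt] := boolP (t \in _).
      rewrite big1// => i _; have [_ ->] := BF i.
      by rewrite indicE mem_set//; move/set_mem : Bt; exact.
    suff [i Bi] : exists i, ~ B i (g i t).
      by rewrite (bigD1 i)//=; have [_ ->] := BF i; rewrite indicE memNset ?mul0r.
    apply: contrapT => /forallNP nB; apply: Bt; apply/mem_set => i _.
    by apply: contrapT; exact: nB.
  rewrite integral_indic//; last exact: fin_bigcap_measurable.
  rewrite setIT; apply: etrans (indg B mB) _; rewrite -prodEFin; apply: eq_bigr => i _.
  rewrite lawg// -Fe; have [_ ->] := BF i; rewrite integral_indic ?setIT//; exact: mB.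
(* The factors other than [i0] form the weight of [integral_weighted_comp]. Its hypothesis on
   indicators is the induction hypothesis with [F i0] replaced by [\1_B]. *)
pose W t := \prod_(i | i != i0) F i (g i t).
have mW : measurable_fun setT W.
  rewrite /W; under eq_fun do rewrite -big_filter.
  by apply: measurable_prod => i _; exact: (measurableT_comp (mF i)).
have e0 i : 0 <= e i.
  by rewrite -lee_fin -Fe; apply: integral_ge0 => x _; rewrite lee_fin.
rewrite [in RHS](bigD1 i0)//= mulrC EFinM -Fe.
under eq_integral do rewrite (bigD1 i0)//= mulrC.
apply: (@integral_weighted_comp _ T _ (measurableTypeR R) R P
  (normal_prob 0 s) (g i0) W (\prod_(i | i != i0) e i) (F i0)) => //.
- by move=> B mB; apply: mg.
- by move=> t; apply: prodr_ge0.
- by apply: prodr_ge0 => i _; exact: e0.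
- move=> B mB.
  have fB : normal_prob 0 s B \is a fin_num by exact: fin_num_measure.
  pose F' i := if i == i0 then \1_B else F i.
  pose e' i := if i == i0 then fine (normal_prob 0 s B) else e i.
  have := IH F' e'; rewrite /F' /e' => IH'.
  transitivity (\int[P]_t (\prod_i F' i (g i t))%:E)%E.
    apply: eq_integral => t _; rewrite [in RHS](bigD1 i0)//= mulrC.
    rewrite /F' eqxx /W; congr (_ * _)%:E; apply: eq_bigr => i /negPf-> //.
  rewrite /F' IH'.
  + rewrite (bigD1 i0)//= eqxx mulrC EFinM fineK//; congr (_%:E * _)%E.
    by apply: eq_bigr => i /negPf->.
  + move=> i il; case: eqP => [_|/eqP ii0]; first by exists B.
    by apply: Fl; rewrite inE negb_or ii0.
  + by move=> i; case: ifP => // _; exact: measurable_indic.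
  + by move=> i x; case: ifP.
  + by move=> i; case: ifP => // _; rewrite integral_indic// setIT fineK.
- exact: mF.
Qed.

(** Markov's inequality: the indicator of [E] is at most [c] times the product, whose integral is
    given by [iid_integral_prod]. *)
Lemma iid_chernoff (E : set T) (F : I -> R -> R) (e : I -> R) (c : R) :
  measurable E -> 0 <= c ->
  (forall i, measurable_fun setT (F i)) -> (forall i x, 0 <= F i x) ->
  (forall i, \int[normal_prob 0 s]_x (F i x)%:E = (e i)%:E)%E ->
  (forall t, E t -> 1 <= c * \prod_i F i (g i t)) ->
  (P E <= (c * \prod_i e i)%:E)%E.
Proof.
move=> mE c0 mF F0 Fe EF; have [mg _ _] := iid.
have mFg : measurable_fun setT (fun t => \prod_i F i (g i t)).
  apply: measurable_prod => i _.
  exact: (@measurableT_comp _ _ _ _ _ _ _ _ _ (mF i) (mg i)).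
have Fg0 t : 0 <= \prod_i F i (g i t) by apply: prodr_ge0.
rewrite EFinM -(iid_integral_prod mF F0 Fe) -ge0_integralZl_EFin//; last 2 first.
- by move=> t _; rewrite lee_fin.
- exact/measurable_EFinP.
rewrite -[X in P X]setIT -integral_indic//.
apply: ge0_le_integral => //=.
- exact/measurable_EFinP/measurable_indic.
- by apply/measurable_EFinP; exact: measurable_funM.
- move=> t _; rewrite -EFinM lee_fin indicE.
  have [/set_mem/EF//|_] := boolP (t \in E).
  by rewrite mulr_ge0.
Qed.

Lemma measurable_linear_tail (a : I -> R) (t : R) :
  measurable [set w | t <= \sum_i a i * g i w].
Proof.
have [mg _ _] := iid.
rewrite -[X in measurable X]setTI; apply: measurable_fun_le => //.
by apply: measurable_sum => i; exact: measurable_funM.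
Qed.

(** Chernoff bound with the parameter [l = t / (s ^+ 2 * A)], which minimizes
    [- l * t + l ^+ 2 * s ^+ 2 * A / 2]. An upper bound [A] on the sum of squares is enough, so that
    one estimate serves all net points. *)
Lemma linear_tail (a : I -> R) (A t : R) : 0 < s -> 0 < A -> 0 <= t ->
  \sum_i a i ^+ 2 <= A ->
  (P [set w | (t <= \sum_i a i * g i w)%R] <=
   (expR (- (t ^+ 2 / (2 * s ^+ 2 * A))))%:E)%E.
Proof.
move=> s0 A0 t0 aA; pose l := t / (s ^+ 2 * A).
have l0 : 0 <= l by rewrite divr_ge0// mulr_ge0 ?sqr_ge0 ?ltW.
apply: (@le_trans _ _ (expR (- (l * t)) *
    \prod_i expR ((l * a i) ^+ 2 * s ^+ 2 / 2))%:E).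
  apply: (iid_chernoff (F := fun i x => expR (l * a i * x))).
  - exact: measurable_linear_tail.
  - exact: expR_ge0.
  - by move=> i; apply: measurableT_comp => //; exact: measurable_funM.
  - by move=> i x; exact: expR_ge0.
  - by move=> i; exact: integral_normal_expR.
  - move=> w /= tw; rewrite -expR_sum -expRD -[leLHS]expR0 ler_expR.
    under eq_bigr do rewrite -mulrA.
    by rewrite -mulr_sumr addrC subr_ge0 ler_wpM2l.
rewrite lee_fin -expR_sum -expRD ler_expR.
have -> : \sum_i (l * a i) ^+ 2 * s ^+ 2 / 2 =
    l ^+ 2 * s ^+ 2 / 2 * \sum_i a i ^+ 2.
  by rewrite mulr_sumr; apply: eq_bigr => i _; field.
apply: (@le_trans _ _ (- (l * t) + l ^+ 2 * s ^+ 2 / 2 * A)).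
  by rewrite lerD2l ler_wpM2l// divr_ge0// mulr_ge0// sqr_ge0.
rewrite le_eqVlt; apply/orP; left; apply/eqP; rewrite /l; field.
by rewrite !gt_eqF.
Qed.

Lemma measurable_sqr_tail (J : pred I) (t : R) :
  measurable [set w | t <= \sum_(i | J i) g i w ^+ 2].
Proof.
have [mg _ _] := iid.
rewrite -[X in measurable X]setTI; apply: measurable_fun_le => //.
under eq_fun do rewrite -big_filter.
by apply: measurable_sum => i; exact: measurable_funX.
Qed.

(** Each index in [J] contributes the moment 2 of [integral_normal_expR_sqr], the others a factor 1.
    The predicate [J] makes it possible to single out the noise vector within the joint noise
    family. *)
Lemma sqr_tail (J : pred I) (t : R) : 0 < s ->
  (P [set w | (t <= \sum_(i | J i) g i w ^+ 2)%R] <=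
   (expR (- (3 / (8 * s ^+ 2) * t)) * 2 ^+ #|J|)%:E)%E.
Proof.
move=> s0; pose l := 3 / (8 * s ^+ 2).
have l0 : 0 <= l by rewrite divr_ge0// mulr_ge0// sqr_ge0.
have -> : 2 ^+ #|J| = \prod_i (if J i then 2 else 1) :> R.
  by rewrite -big_mkcond/= prodr_const.
apply: (iid_chernoff (F := fun i x => if J i then expR (l * x ^+ 2) else 1)).
- exact: measurable_sqr_tail.
- exact: expR_ge0.
- move=> i; case: (J i) => //; apply: measurableT_comp => //.
  by apply: measurable_funM => //.
- by move=> i x; case: ifP => // _; exact: expR_ge0.
- move=> i; case: (J i); first exact: integral_normal_expR_sqr.
  by rewrite integral_cst// mul1e [LHS]probability_setT.
- move=> w /= tw; rewrite -big_mkcond/= -expR_sum -expRD -[leLHS]expR0 ler_expR.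
  by rewrite -mulr_sumr addrC subr_ge0 ler_wpM2l.
Qed.
End iid.

(** * Euclidean norm, inner product and least singular value *)

Section vnorm_theory.
Context (R : realType) (p : nat).
Implicit Types (u v w : 'cV[R]_p) (M : 'M[R]_p).

Definition dot u v : R := \sum_i u i ord0 * v i ord0.

Lemma dotC u v : dot u v = dot v u.
Proof. by apply: eq_bigr => i _; rewrite mulrC. Qed.

Lemma dotDl u v w : dot (u + v) w = dot u w + dot v w.
Proof. by rewrite -big_split; apply: eq_bigr => i _; rewrite mxE mulrDl. Qed.

Lemma dotZl a u v : dot (a *: u) v = a * dot u v.
Proof. by rewrite mulr_sumr; apply: eq_bigr => i _; rewrite mxE mulrA. Qed.

Lemma dotDr u v w : dot u (v + w) = dot u v + dot u w.
Proof. by rewrite dotC dotDl !(dotC u). Qed.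

Lemma dotZr a u v : dot u (a *: v) = a * dot u v.
Proof. by rewrite dotC dotZl dotC. Qed.

Lemma dot0l v : dot 0 v = 0.
Proof. by rewrite -(scale0r 0) dotZl mul0r. Qed.

Lemma vnorm_ge0 v : 0 <= vnorm v.
Proof. exact: sqrtr_ge0. Qed.

Lemma sqr_vnormE v : vnorm v ^+ 2 = \sum_i v i ord0 ^+ 2.
Proof. by rewrite sqr_sqrtr// sumr_ge0// => i _; exact: sqr_ge0. Qed.

Lemma sqr_vnorm_dot v : vnorm v ^+ 2 = dot v v.
Proof. by rewrite sqr_vnormE; apply: eq_bigr => i _; rewrite expr2. Qed.

Lemma vnorm_eq0 v : (vnorm v == 0) = (v == 0).
Proof.
rewrite -[LHS](@sqrf_eq0 R) sqr_vnormE psumr_eq0; last first.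
  by move=> i _; exact: sqr_ge0.
apply/allP/eqP => [v0|-> i _]; last first.
  by rewrite mxE expr0n/= eqxx.
apply/matrixP => i j; rewrite mxE ord1.
by apply/eqP; rewrite -sqrf_eq0; apply: v0; rewrite mem_index_enum.
Qed.

Lemma vnormZ a v : vnorm (a *: v) = `|a| * vnorm v.
Proof.
apply/eqP; rewrite -(@eqrXn2 _ 2) ?mulr_ge0 ?vnorm_ge0//.
by rewrite exprMn !sqr_vnorm_dot dotZl dotZr mulrA real_normK// num_real.
Qed.

(** Cauchy-Schwarz, from expanding the squared norm of [vnorm v *: u - vnorm u *: v]. *)
Lemma dot_le u v : dot u v <= vnorm u * vnorm v.
Proof.
have [->|u0] := eqVneq u 0.
  by rewrite dot0l mulr_ge0 ?vnorm_ge0.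
have [->|v0] := eqVneq v 0.
  by rewrite dotC dot0l mulr_ge0 ?vnorm_ge0.
have nu0 : 0 < vnorm u by rewrite lt_def vnorm_eq0 u0 vnorm_ge0.
have nv0 : 0 < vnorm v by rewrite lt_def vnorm_eq0 v0 vnorm_ge0.
have := sqr_ge0 (vnorm (vnorm v *: u + (- vnorm u) *: v)).
rewrite sqr_vnorm_dot !(dotDl, dotDr, dotZl, dotZr) -!sqr_vnorm_dot (dotC v u) => H.
rewrite -(@ler_pM2l _ (vnorm u * vnorm v)) ?mulr_gt0//.
by rewrite -subr_ge0 -(@pmulr_rge0 _ 2)//; apply: le_trans H _; rewrite le_eqVlt;
  apply/orP; left; apply/eqP; ring.
Qed.

Lemma vnormD u v : vnorm (u + v) <= vnorm u + vnorm v.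
Proof.
rewrite -(@ler_pXn2r _ 2) ?nnegrE ?addr_ge0 ?vnorm_ge0//.
rewrite sqrrD !sqr_vnorm_dot dotDl !dotDr (dotC v u).
have := dot_le u v; lra.
Qed.

Lemma vnormN v : vnorm (- v) = vnorm v.
Proof. by rewrite -scaleN1r vnormZ normrN1 mul1r. Qed.

Lemma sigma_min_vnorm M v : sigma_min M * vnorm v <= vnorm (M *m v).
Proof.
have [->|v0] := eqVneq v 0.
  have /eqP -> : vnorm (0 : 'cV[R]_p) == 0 by rewrite vnorm_eq0.
  by rewrite mulr0 vnorm_ge0.
have nv0 : 0 < vnorm v by rewrite lt_def vnorm_eq0 v0 vnorm_ge0.
rewrite -ler_pdivlMr//; apply: ge_inf.
  by exists 0 => _ [w _ <-]; exact: vnorm_ge0.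
exists ((vnorm v)^-1 *: v) => /=.
  by rewrite vnormZ ger0_norm ?invr_ge0 ?vnorm_ge0// mulVf// gt_eqF.
by rewrite -scalemxAr vnormZ ger0_norm ?invr_ge0 ?vnorm_ge0// mulrC.
Qed.

End vnorm_theory.

(** * A finite net of the unit ball and the operator norm *)

(* The lattice points of Z^p in the ball of radius 4 sqrt p; dividing by
   4 sqrt p they form a 1/4-net of the unit ball.  Zero has two signed
   representations, which is harmless as only upper bounds on the number of
   points matter. *)
Section net.
Context (R : realType) (p : nat).

(** A sign bit and an absolute value. The range up to [4 * p] is an integer bound that covers
    [4 sqrt p], the largest coordinate in the ball. *)
Definition signed_int (c : 'I_(4 * p).+1 * bool) : R := (-1) ^+ c.2 * c.1%:R.

Definition lattice := {ffun 'I_p -> 'I_(4 * p).+1 * bool}.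

Definition in_net (z : lattice) : bool :=
  \sum_i signed_int (z i) ^+ 2 <= 16 * p%:R.

Lemma sum_half_pow_le2 n : \sum_(k < n) (2^-1 : R) ^+ k <= 2.
Proof.
suff -> : \sum_(k < n) (2^-1 : R) ^+ k = 2 - 2 * 2^-1 ^+ n.
  by rewrite gerBl mulr_ge0// exprn_ge0// invr_ge0.
elim: n => [|n IH]; first by rewrite big_ord0 expr0 mulr1 subrr.
by rewrite big_ord_recr /= IH exprS; field.
Qed.

Lemma expR1_ge2 : 2 <= expR 1 :> R.
Proof. by have := expR_ge1Dx (1 : R); rewrite -[1 + 1]/(2 : R). Qed.

(** Since [k <= k ^ 2] and [2 <= expR 1], the term of absolute value [k] is at most [2^-1 ^+ k]; the
    two signs double the geometric sum. *)
Lemma sum_expR_signed_int : \sum_c expR (- signed_int c ^+ 2) <= 4.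
Proof.
rewrite -(pair_bigA _ (fun k b => expR (- signed_int (k, b) ^+ 2)))/=.
apply: (@le_trans _ _ (\sum_(k < (4 * p).+1) 2 * (2^-1 : R) ^+ k)); last first.
  rewrite -mulr_sumr; have := sum_half_pow_le2 (4 * p).+1; lra.
apply: ler_sum => k _.
have kb b : expR (- signed_int (k, b) ^+ 2) <= 2^-1 ^+ k :> R.
  rewrite /signed_int exprMn sqrr_sign mul1r expRN exprVn.
  rewrite lef_pV2 ?posrE ?expR_gt0 ?exprn_gt0//.
  apply: (@le_trans _ _ (expR 1 ^+ k)).
    by rewrite lerXn2r ?nnegrE ?expR_ge0// expR1_ge2.
  rewrite -expRM_natl ler_expR mulr1 -natrX ler_nat.
  by case: (k : nat) => // n; rewrite -[X in (X <= _)%N]muln1 leq_mul.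
by rewrite big_bool/= mulr_natl mulr2n lerD.
Qed.

(** Counting with Gaussian weights: the product of the [expR (16 - z_i ^ 2)] is at least 1 on the
    net, and its sum over the whole lattice factors into [p] sums, each at most
    [4 * expR 16 <= expR 18]. *)
Lemma card_net : #|in_net|%:R <= expR (18 * p%:R) :> R.
Proof.
rewrite -sum1_card natr_sum.
apply: (@le_trans _ _ (\sum_(z : lattice)
    \prod_i (expR 16 * expR (- signed_int (z i) ^+ 2)))).
  rewrite big_mkcond; apply: ler_sum => z _; case: ifPn => [zn|_]; last first.
    by apply: prodr_ge0 => i _; rewrite mulr_ge0// expR_ge0.
  under eq_bigr do rewrite -expRD.
  rewrite -expR_sum -[leLHS]expR0 ler_expR big_split/= sumrN subr_ge0.
  by rewrite sumr_const card_ord -[leRHS]mulr_natr; exact: zn.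
rewrite -(bigA_distr_bigA (fun _ c => expR 16 * expR (- signed_int c ^+ 2)))/=.
rewrite prodr_const card_ord expRM_natr -mulr_sumr.
rewrite lerXn2r ?nnegrE ?expR_ge0//.
  by rewrite mulr_ge0 ?expR_ge0// sumr_ge0// => c _; exact: expR_ge0.
have -> : 18 = 16 + 2 * 1 :> R by ring.
rewrite (expRD 16) expRM_natl ler_wpM2l ?expR_ge0// (le_trans sum_expR_signed_int)//.
have := expR1_ge2; nra.
Qed.

(** Each coordinate of [S *: u] is rounded towards zero, where [S = 4 sqrt p]. Rounding towards zero
    keeps the point in the ball; each coordinate of [u] moves by at most [1 / S], so the squared
    error is at most [p / S ^ 2 = 1 / 16]. *)
Lemma net_round (u : 'cV[R]_p) : (0 < p)%N -> vnorm u <= 1 ->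
  exists2 z : lattice, in_net z &
    let u' := \col_i (signed_int (z i) / (4 * Num.sqrt p%:R)) in
    vnorm u' <= 1 /\ vnorm (u - u') <= 4^-1.
Proof.
move=> p0 u1; set S := 4 * Num.sqrt p%:R.
have p1 : 1 <= p%:R :> R by rewrite ler1n.
have S2 : S ^+ 2 = 16 * p%:R by rewrite exprMn sqr_sqrtr//; ring.
have S0 : 0 < S by rewrite mulr_gt0// sqrtr_gt0 ltr0n.
have Sp : S <= 4 * p%:R.
  rewrite ler_pM2l// -[leRHS]ger0_norm// -sqrtr_sqr ler_wsqrtr//.
  by rewrite expr2 ler_peMr.
have u2 : \sum_i u i ord0 ^+ 2 <= 1 by rewrite -sqr_vnormE exprn_ile1// vnorm_ge0.
have ui1 i : `|u i ord0| <= 1.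
  rewrite -(@ler_pXn2r _ 2) ?nnegrE// expr1n real_normK ?num_real//.
  apply: le_trans u2; rewrite (bigD1 i)//= lerDl sumr_ge0// => j _.
  exact: sqr_ge0.
pose k i := Num.trunc (S * `|u i ord0|).
have kle i : (k i)%:R <= S * `|u i ord0| by rewrite truncn_le mulr_ge0// ltW.
have kgt i : S * `|u i ord0| <= (k i)%:R + 1 by rewrite natr1 ltW// truncnS_gt.
have kp i : (k i < (4 * p).+1)%N.
  rewrite ltnS -(ler_nat R) (le_trans (kle i))// natrM (le_trans _ Sp)//.
  by rewrite ler_piMr// ltW.
pose z : lattice := [ffun i => (Ordinal (kp i), u i ord0 < 0)].
have zE i : signed_int (z i) = (-1) ^+ (u i ord0 < 0)%R * (k i)%:R.
  by rewrite /z /signed_int ffunE.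
have zu i : signed_int (z i) ^+ 2 <= S ^+ 2 * u i ord0 ^+ 2.
  rewrite zE exprMn sqrr_sign mul1r -[u i ord0 ^+ 2]real_normK ?num_real//.
  by rewrite -exprMn lerXn2r ?nnegrE// mulr_ge0// ltW.
have zd i : (u i ord0 - signed_int (z i) / S) ^+ 2 <= (16 * p%:R)^-1.
  rewrite -S2 zE {1}[u i ord0]numEsign -mulrA -mulrBr exprMn sqrr_sign mul1r.
  have -> : `|u i ord0| - (k i)%:R / S = (S * `|u i ord0| - (k i)%:R) / S.
    by field; rewrite gt_eqF.
  rewrite exprMn exprVn ler_piMl ?invr_ge0 ?exprn_ge0 ?(ltW S0)//.
  by rewrite exprn_ile1// ?subr_ge0// lerBlDl.
exists z.
  rewrite /in_net -S2; apply: le_trans (ler_sum _ (fun i _ => zu i)) _.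
  by rewrite -mulr_sumr ler_piMr// exprn_ge0// ltW.
move=> u'; split.
  rewrite -(@ler_pXn2r _ 2) ?nnegrE ?vnorm_ge0// expr1n sqr_vnormE.
  apply: le_trans u2; apply: ler_sum => i _.
  by rewrite mxE exprMn exprVn ler_pdivrMr ?exprn_gt0// mulrC.
rewrite -(@ler_pXn2r _ 2) ?nnegrE ?vnorm_ge0 ?invr_ge0// sqr_vnormE.
apply: (@le_trans _ _ (\sum_(i < p) (16 * p%:R)^-1)).
  by apply: ler_sum => i _; rewrite !mxE.
rewrite sumr_const card_ord -mulr_natr le_eqVlt; apply/orP; left; apply/eqP.
by field; rewrite gt_eqF// (lt_le_trans _ p1).
Qed.

(** The operator norm is handled as the supremum of the set [E] of values of the bilinear form on
    unit balls. The supremum is first shown to be finite, so that [sup E <= A + 2^-1 * sup E] can be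
    solved for it. *)
Lemma net_opnorm (N : 'M[R]_p) (A : R) : (0 < p)%N ->
  (forall z w : lattice, in_net z -> in_net w ->
     \sum_i \sum_j signed_int (z i) * signed_int (w j) * N i j
       <= 16 * p%:R * A) ->
  forall v, vnorm (N *m v) <= 2 * A * vnorm v.
Proof.
move=> p0 NA.
pose E := [set x | exists u v : 'cV[R]_p,
  [/\ vnorm u <= 1, vnorm v <= 1 & x = dot u (N *m v)]].
pose S := 4 * Num.sqrt p%:R : R.
have S2 : S ^+ 2 = 16 * p%:R by rewrite exprMn sqr_sqrtr//; ring.
have S0 : 0 < S by rewrite mulr_gt0// sqrtr_gt0 ltr0n.
have v0 : vnorm (0 : 'cV[R]_p) = 0 by apply/eqP; rewrite vnorm_eq0.
have vij (v : 'cV[R]_p) i : vnorm v <= 1 -> `|v i ord0| <= 1.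
  move=> v1; rewrite -(@ler_pXn2r _ 2) ?nnegrE// expr1n real_normK ?num_real//.
  apply: (@le_trans _ _ (vnorm v ^+ 2)); last by rewrite exprn_ile1// vnorm_ge0.
  rewrite sqr_vnormE (bigD1 i)//= lerDl sumr_ge0// => j _; exact: sqr_ge0.
have supE : has_sup E.
  split; first by exists 0, 0, 0; rewrite v0 mulmx0 dot0l.
  exists (\sum_i \sum_j `|N i j|) => _ [u [v [u1 v1 ->]]].
  apply: ler_sum => i _; rewrite mxE mulr_sumr; apply: ler_sum => j _.
  apply: le_trans (ler_norm _) _; rewrite !normrM mulrA mulrAC.
  by rewrite ler_piMl// mulr_ile1// vij.
have Esup (u v : 'cV[R]_p) : vnorm u <= 1 -> vnorm v <= 1 ->
    dot u (N *m v) <= sup E.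
  by move=> u1 v1; apply: sup_upper_bound => //; exists u, v.
(* By homogeneity: [4 *: u] still lies in the unit ball. *)
have quarter (u v : 'cV[R]_p) : vnorm u <= 4^-1 -> vnorm v <= 1 ->
    dot u (N *m v) <= 4^-1 * sup E /\ dot v (N *m u) <= 4^-1 * sup E.
  move=> u4 v1; have u1 : vnorm (4 *: u) <= 1.
    by rewrite vnormZ ger0_norm//; lra.
  have := Esup _ _ u1 v1; have := Esup _ _ v1 u1.
  by rewrite -scalemxAr dotZl dotZr; lra.
(* Rounding both arguments to the net costs at most half of the supremum. *)
have E2A : sup E <= 2 * A.
  suff : sup E <= A + 2^-1 * sup E by lra.
  apply: ge_sup; first by case: supE.
  move=> _ [u [v [u1 v1 ->]]].
  have [z zn [u'1 uu']] := net_round p0 u1.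
  have [w wn [v'1 vv']] := net_round p0 v1.
  set u' := (\col_i _) in u'1 uu'; set v' := (\col_i _) in v'1 vv'.
  have -> : dot u (N *m v) =
      dot u' (N *m v') + dot (u - u') (N *m v) + dot u' (N *m (v - v')).
    by rewrite mulmxBr -scaleN1r -[- (N *m v')]scaleN1r !(dotDl, dotDr, dotZl, dotZr); ring.
  have [H1 _] := quarter _ _ uu' v1; have [_ H2] := quarter _ _ vv' u'1.
  suff : dot u' (N *m v') <= A by lra.
  have := NA z w zn wn; rewrite -S2 => zwA.
  rewrite -(@ler_pM2l _ (S ^+ 2)) ?exprn_gt0//; apply: le_trans zwA.
  rewrite le_eqVlt; apply/orP; left; apply/eqP.
  rewrite mulr_sumr; apply: eq_bigr => i _.
  rewrite !mxE !mulr_sumr; apply: eq_bigr => j _; rewrite mxE.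
  by rewrite -/S; field; rewrite gt_eqF.
move=> v.
have [->|vn0] := eqVneq v 0; first by rewrite mulmx0 v0 mulr0.
have nv0 : 0 < vnorm v by rewrite lt_def vnorm_eq0 vn0 vnorm_ge0.
have [->|Nv0] := eqVneq (N *m v) 0.
  rewrite v0 mulr_ge0 ?vnorm_ge0//; apply: le_trans E2A.
  by have := Esup 0 0; rewrite v0 mulmx0 dot0l; apply.
have nNv0 : 0 < vnorm (N *m v) by rewrite lt_def vnorm_eq0 Nv0 vnorm_ge0.
have unit (x : 'cV[R]_p) : 0 < vnorm x -> vnorm ((vnorm x)^-1 *: x) <= 1.
  by move=> x0; rewrite vnormZ ger0_norm ?invr_ge0 ?vnorm_ge0// mulVf ?gt_eqF.
rewrite -ler_pdivrMr//.
apply: le_trans (le_trans (Esup _ _ (unit _ nNv0) (unit _ nv0)) E2A).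
rewrite -scalemxAr dotZl dotZr -sqr_vnorm_dot le_eqVlt.
by apply/orP; left; apply/eqP; field; rewrite !gt_eqF.
Qed.

End net.

(** * Deterministic perturbation of linear systems *)

Section perturbation.
Context (R : realType) (p : nat).
Implicit Types (M N : 'M[R]_p) (v : 'cV[R]_p).

Lemma vnorm_mulmx_perturb M N (delta : R) :
  (forall v, vnorm (N *m v) <= delta * vnorm v) ->
  forall v, (sigma_min M - delta) * vnorm v <= vnorm ((M + N) *m v).
Proof.
move=> Nd v; have := sigma_min_vnorm M v; have := Nd v.
have := vnormD ((M + N) *m v) (- (N *m v)).
by rewrite vnormN mulmxDl addrK; lra.
Qed.

Lemma unitmx_lower_bound M (c : R) : 0 < c ->
  (forall v, c * vnorm v <= vnorm (M *m v)) -> M \in unitmx.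
Proof.
(* [kermx] is a left kernel, hence the passage to the transpose. *)
move=> c0 Mc; rewrite -unitmx_tr -row_free_unit -kermx_eq0.
apply/negPn/negP => /rowV0Pn[v /sub_kermxP vM v0].
have Mv : M *m v^T = 0 by apply: trmx_inj; rewrite trmx_mul trmxK vM trmx0.
have := Mc v^T; rewrite Mv (eqP (_ : vnorm 0 == 0)) ?vnorm_eq0//.
apply/negP; rewrite -ltNge mulr_gt0// lt_def vnorm_ge0 andbT vnorm_eq0.
by rewrite -(inj_eq (@trmx_inj _ _ _)) trmxK trmx0.
Qed.

(** The difference of the two solutions is mapped by [M + N] to [e - N *m b], and [M + N] expands
    norms by at least [sigma_min M - delta], which is positive. *)
Lemma solution_perturb M N (q e : 'cV[R]_p) (delta : R) :
  M \in unitmx -> delta < sigma_min M ->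
  (forall v, vnorm (N *m v) <= delta * vnorm v) ->
  let b := invmx M *m q in
  M + N \in unitmx /\
  (sigma_min M - delta) * vnorm (invmx (M + N) *m (q + e) - b)
    <= vnorm e + delta * vnorm b.
Proof.
move=> Mu dM Nd b; have lb := vnorm_mulmx_perturb M Nd.
have Au : M + N \in unitmx by apply: unitmx_lower_bound lb; rewrite subr_gt0.
split=> //; apply: le_trans (lb _) _.
rewrite mulmxBr mulKVmx// mulmxDl mulKVmx//.
have -> : q + e - (q + N *m b) = e + - (N *m b).
  by rewrite opprD addrACA subrr add0r.
by apply: le_trans (vnormD _ _) _; rewrite vnormN lerD2l.
Qed.

End perturbation.

(** * Elementary exponential and union bounds *)

(** Used with [n = 10] and a rational [x] to reduce numerical lower bounds on exponentials to
    rational arithmetic. *)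
Lemma exprn_le_expR (R : realType) (n : nat) (x : R) : 0 <= x ->
  (1 + x) ^+ n <= expR (n%:R * x).
Proof.
move=> x0; rewrite expRM_natl lerXn2r ?nnegrE ?expR_ge0 ?addr_ge0//.
exact: expR_ge1Dx.
Qed.

Section union_bound.
Context d (T : measurableType d) (R : realType) (P : probability T R).

Lemma union_bound (K : finType) (Q : {pred K}) (F : K -> set T) (c : R) :
  (forall k, k \in Q -> measurable (F k)) ->
  (forall k, k \in Q -> P (F k) <= c%:E)%E ->
  (P (\bigcup_(k in [set` Q]) F k) <= (c * #|Q|%:R)%:E)%E.
Proof.
move=> mF Fc; rewrite bigcup_pred mulr_natr -sumr_const -sumEFin.
suff [] : measurable (\big[setU/set0]_(k in Q) F k) /\
    (P (\big[setU/set0]_(k in Q) F k) <= \sum_(k in Q) c%:E)%E by [].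
elim/big_rec2 : _ => [|k x A kQ [mA Ax]]; first by rewrite measure0.
split; first by apply: measurableU => //; exact: mF.
apply: le_trans (measureU2 _ (mF _ kQ) mA) _.
by apply: leeD => //; exact: Fc.
Qed.

End union_bound.

(** * Tails of the noise vector and of the noise matrix *)

Section gaussian_noise.
Context d (T : measurableType d) (R : realType) (P : probability T R).
Context (s L : R).
Hypothesis s0 : 0 < s.
Hypothesis L1 : 1 <= L.

Let LL : L <= L ^+ 2. Proof. by rewrite expr2 ler_peMl// (le_trans _ L1). Qed.

(* The Chernoff bound for the chi-squared law fails with a single degree of
   freedom, where the Gaussian tail has to be used. *)
Lemma sharp_sqr_tail (I : finType) (g : I -> T -> R) (J : pred I) :
  iid_gaussian P g s -> (0 < #|J|)%N ->
  (P [set w | (19 / 5 * (s * Num.sqrt #|J|%:R * L) ^+ 2 <=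
      \sum_(i | J i) g i w ^+ 2)%R] <= (9 / 10 * expR (- L))%:E)%E.
Proof.
move=> iid; rewrite leq_eqVlt => /orP[/eqP/esym J1|J2].
  have [i0 J0] := mem_card1 J1.
  have mtail a : measurable [set w | 97 / 50 * (s * L) <= \sum_i a i * g i w].
    exact: (measurable_linear_tail iid).
  pose a e i : R := if i == i0 then e else 0.
  have aE e w : \sum_i a e i * g i w = e * g i0 w.
    rewrite (bigD1 i0)//= /a eqxx big1 ?addr0// => i /negPf->.
    by rewrite mul0r.
  (* One-sided tails for [e = 1] and [e = -1], each with half of the budget [9 / 10]. The threshold
     [97 / 50] works because its square is below [19 / 5]. *)
  have tail e : e ^+ 2 = 1 ->
      (P [set w | (97 / 50 * (s * L) <= \sum_i a e i * g i w)%R] <=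
       (9 / 20 * expR (- L))%:E)%E.
    move=> e1; apply: le_trans (linear_tail iid (A := 1) _ _ _ _) _ => //.
    - by rewrite mulr_ge0// mulr_ge0 ?ltW// (lt_le_trans _ L1).
    - rewrite (bigD1 i0)//= /a eqxx big1 ?addr0 ?e1// => i /negPf->.
      by rewrite expr0n.
    - rewrite lee_fin.
      have -> : (97 / 50 * (s * L)) ^+ 2 / (2 * s ^+ 2 * 1) =
          9409 / 5000 * L ^+ 2 by field; rewrite gt_eqF.
      apply: (@le_trans _ _ (expR (- (10 * (11 / 125)) - L))).
        by rewrite ler_expR; have := LL; have := L1; lra.
      rewrite expRD ler_wpM2r ?expR_ge0// expRN invf_ple ?posrE ?expR_gt0//.
      have := @exprn_le_expR R 10 (11 / 125); lra.
  pose E e := [set w | 97 / 50 * (s * L) <= \sum_i a e i * g i w].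
  apply: (@le_trans _ _ (P (E 1 `|` E (-1)))).
    apply: le_measure.
    - by apply/mem_set; exact: (measurable_sqr_tail iid).
    - by apply/mem_set; apply: measurableU; exact: mtail.
    - move=> w /=; rewrite /E /= !aE mul1r mulN1r J1 sqrtr1 mulr1.
      rewrite (eq_bigl (pred1 i0)) ?big_pred1_eq => [H|i]; last exact: J0.
      have sL0 : 0 <= s * L by rewrite mulr_ge0 ?ltW// (lt_le_trans _ L1).
      have [g0|g0] := leP 0 (g i0 w); [left|right]; nra.
  apply: le_trans (measureU2 _ (mtail _) (mtail _)) _.
  have -> : 9 / 10 * expR (- L) = 9 / 20 * expR (- L) + 9 / 20 * expR (- L).
    by field.
  rewrite EFinD; apply: leeD; apply: tail; first exact: expr1n.
  by rewrite sqrrN expr1n.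
apply: le_trans (sqr_tail iid _ _ s0) _; rewrite lee_fin.
have -> : 3 / (8 * s ^+ 2) * (19 / 5 * (s * Num.sqrt #|J|%:R * L) ^+ 2) =
    #|J|%:R * (57 / 40 * L ^+ 2).
  by rewrite !exprMn sqr_sqrtr//; field; rewrite gt_eqF.
rewrite -mulrN expRM_natl -exprMn.
(* The bound is [q ^+ #|J|] with [q <= 1], so two degrees of freedom are the worst case. *)
set q := expR _ * 2.
have q0 : 0 <= q by rewrite mulr_ge0// expR_ge0.
have q1 : q <= 1.
  rewrite /q expRN mulrC ler_pdivrMr ?expR_gt0// mul1r.
  by apply: le_trans (expR1_ge2 R) _; rewrite ler_expR; have := LL; have := L1; lra.
apply: (@le_trans _ _ (q ^+ 2)); first by rewrite ler_wiXn2l.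
rewrite /q exprMn -expRM_natl.
apply: (@le_trans _ _ (expR (- (10 * (37 / 200)) - L) * 2 ^+ 2)).
  by rewrite ler_pM2r ?exprn_gt0// ler_expR; have := LL; have := L1; lra.
rewrite expRD mulrAC ler_wpM2r ?expR_ge0// expRN mulrC.
rewrite ler_pdivrMr ?expR_gt0//.
have := @exprn_le_expR R 10 (37 / 200); lra.
Qed.

Context (p : nat) (Nf : 'I_p -> 'I_p -> T -> R) (nf : 'I_p -> T -> R).
Hypothesis p0 : (0 < p)%N.
Hypothesis iid : iid_gaussian P (noise_family Nf nf) s.

(** The constant [39 / 20] has square just above the [19 / 5] of [sharp_sqr_tail]. The vector gets
    nine tenths of the failure probability. *)
Lemma noise_vector_tail : exists B, [/\ measurable B,
  (P B <= (9 / 10 * expR (- L))%:E)%E &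
  forall t, ~ B t ->
    vnorm (\col_i nf i t) <= 39 / 20 * (s * Num.sqrt p%:R * L)].
Proof.
pose J (k : 'I_p * 'I_p + 'I_p) := if k is inr _ then true else false.
have Jp : #|J| = p.
  by rewrite -sum1_card big_sumType/= big_pred0// add0n sum1_card card_ord.
exists [set w | 19 / 5 * (s * Num.sqrt p%:R * L) ^+ 2 <=
  \sum_(k | J k) noise_family Nf nf k w ^+ 2]; split.
- exact: (measurable_sqr_tail iid).
- by rewrite -{1}Jp; apply: sharp_sqr_tail => //; rewrite Jp.
- move=> t /= /negP; rewrite -ltNge big_sumType/= big_pred0// add0r => H.
  have t0 : 0 <= s * Num.sqrt p%:R * L.
    by rewrite !mulr_ge0 ?sqrtr_ge0 ?ltW// (lt_le_trans _ L1).
  rewrite -(@ler_pXn2r _ 2) ?nnegrE ?vnorm_ge0 ?(mulr_ge0 _ t0)// sqr_vnormE.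
  under eq_bigr do rewrite mxE.
  move: H; nra.
Qed.

(** Union bound over pairs of net points: at most [expR (36 * p)] pairs, each failing with
    probability at most [expR (- (81 / 2 * p * L ^+ 2))]. With [L] and [p] at least 1, the excess of
    [81 / 2] over 36 leaves the remaining tenth of the failure probability. *)
Lemma noise_matrix_tail : exists B, [/\ measurable B,
  (P B <= (10^-1 * expR (- L))%:E)%E &
  forall t, ~ B t -> forall v,
    vnorm ((\matrix_(i, j) Nf i j t) *m v) <=
    18 * (s * Num.sqrt p%:R * L) * vnorm v].
Proof.
set tau := s * Num.sqrt p%:R * L.
have L0 : 0 < L by apply: lt_le_trans L1.
have p1 : 1 <= p%:R :> R by rewrite ler1n.
have tau0 : 0 <= tau by rewrite !mulr_ge0 ?sqrtr_ge0 ?ltW.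
pose Q := [predX @in_net R p & @in_net R p].
(* The bilinear form is a linear form in the joint noise, with zero coefficients on the vector
   part. *)
pose a (zw : lattice p * lattice p) (k : 'I_p * 'I_p + 'I_p) : R :=
  if k is inl ij then signed_int R (zw.1 ij.1) * signed_int R (zw.2 ij.2) else 0.
have aE zw t : \sum_k a zw k * noise_family Nf nf k t =
    \sum_i \sum_j signed_int R (zw.1 i) * signed_int R (zw.2 j) * Nf i j t.
  rewrite big_sumType/= [X in _ + X]big1 ?addr0 => [|i _]; last by rewrite mul0r.
  by rewrite pair_bigA.
have a2 zw : \sum_k a zw k ^+ 2 =
    (\sum_i signed_int R (zw.1 i) ^+ 2) * (\sum_i signed_int R (zw.2 i) ^+ 2).
  rewrite big_sumType/= [X in _ + X]big1 ?addr0 => [|i _]; last by rewrite expr0n.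
  rewrite mulr_suml -(pair_bigA _ (fun i j =>
    (signed_int R (zw.1 i) * signed_int R (zw.2 j)) ^+ 2))/=.
  by apply: eq_bigr => i _; rewrite mulr_sumr; apply: eq_bigr => j _; rewrite exprMn.
pose F zw := [set t | 16 * p%:R * (9 * tau) <=
  \sum_k a zw k * noise_family Nf nf k t].
have mF zw : measurable (F zw) by exact: (measurable_linear_tail iid).
exists (\bigcup_(zw in [set` Q]) F zw); split.
- by rewrite bigcup_pred; apply: bigsetU_measurable => zw _.
- apply: le_trans (union_bound (c := expR (- (81 / 2 * p%:R * L ^+ 2))) _ _) _.
  + by move=> zw _.
  + move=> zw /andP[/= z_net w_net].
    apply: le_trans (linear_tail iid (A := (16 * p%:R) ^+ 2) _ _ _ _) _ => //.
    * by rewrite exprn_gt0// mulr_gt0// ltr0n.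
    * by apply: mulr_ge0; apply: mulr_ge0.
    * rewrite a2 expr2 ler_pM ?sumr_ge0// => i _; exact: sqr_ge0.
    * rewrite lee_fin ler_expR lerN2 le_eqVlt; apply/orP; left; apply/eqP.
      rewrite /tau !exprMn sqr_sqrtr//; field.
      by rewrite !gt_eqF// (lt_le_trans _ p1).
  + rewrite lee_fin cardX natrM.
    apply: (@le_trans _ _ (expR (- (81 / 2 * p%:R * L ^+ 2)) *
        (expR (18 * p%:R) * expR (18 * p%:R)))).
      by rewrite ler_wpM2l ?expR_ge0// ler_pM// card_net.
    rewrite -!expRD.
    apply: (@le_trans _ _ (expR (- (10 * (7 / 20)) - L))).
      rewrite ler_expR.
      have : L <= p%:R * L ^+ 2 by rewrite (le_trans LL)// ler_peMl// sqr_ge0.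
      have : p%:R <= p%:R * L ^+ 2 by rewrite ler_peMr// (le_trans L1).
      by lra.
    rewrite expRD ler_wpM2r ?expR_ge0// expRN lef_pV2 ?posrE ?expR_gt0//.
    have := @exprn_le_expR R 10 (7 / 20); lra.
- move=> t nB v.
  rewrite (_ : 18 * tau = 2 * (9 * tau)); last by ring.
  apply: net_opnorm => // z w z_net w_net.
  rewrite leNgt; apply/negP => H; apply: nB.
  exists (z, w); first by apply/andP.
  rewrite /F /= aE /=; apply: ltW; apply: lt_le_trans H _.
  rewrite le_eqVlt; apply/orP; left; apply/eqP.
  by apply: eq_bigr => i _; apply: eq_bigr => j _; rewrite mxE.
Qed.

End gaussian_noise.

(** * Combination of the tail bounds with the perturbation estimate *)

Theorem theoremC1 (R : realType) :
  exists C : R, 1 <= C /\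
  forall (n p : nat) (X : 'M[R]_(n, p)) (y : 'cV[R]_n) (eta nu sigma : R),
    (X^T *m X) \in unitmx ->
    0 < eta < 1 ->
    0 < nu < (expR 1)^-1 ->
    0 < sigma ->
    forall (d : measure_display) (T : measurableType d) (P : probability T R)
           (Nf : 'I_p -> 'I_p -> T -> R) (nf : 'I_p -> T -> R),
    iid_gaussian P (noise_family Nf nf) sigma ->
    let beta_hat : 'cV[R]_p := invmx (X^T *m X) *m (X^T *m y) in
    let XtX_t (t : T) : 'M[R]_p := X^T *m X + \matrix_(i, j) Nf i j t in
    let Xty_t (t : T) : 'cV[R]_p := X^T *m y + \col_i nf i t in
    let beta_t (t : T) : 'cV[R]_p := invmx (XtX_t t) *m Xty_t t in
    sigma_min (X^T *m X) >= 2 * C / eta * (sigma * Num.sqrt p%:R * ln nu^-1) ->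
    exists A : set T, [/\ measurable A,
      A `<=` [set t | XtX_t t \in unitmx /\
                      vnorm (beta_t t - beta_hat) <= 2 * eta * vnorm beta_hat + eta / C]
      & ((1 - nu)%:E <= P A)%E].
Proof.
exists 360; split; first by rewrite ler1n.
move=> n p X y eta nu sigma Mu /andP[eta0 eta1] /andP[nu0 nu1] s0 d T P Nf nf iid.
move=> beta_hat XtX_t Xty_t beta_t; set L := ln nu^-1 => sM.
(* In dimension 0 all norms vanish; the tail bounds assume [0 < p]. *)
have [p0|p0] := posnP p.
  subst p; exists setT; split=> //; last first.
    by rewrite probability_setT lee_fin gerBl ltW.
  have v0 (v : 'cV[R]_0) : vnorm v = 0.
    by apply/eqP; rewrite vnorm_eq0; apply/eqP; exact: flatmx0.
  move=> t _; split; first by rewrite unitmxE det_mx00 unitr1.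
  by rewrite !v0 mulr0 add0r divr_ge0// ltW.
have nuL : expR (- L) = nu by rewrite /L -lnV ?posrE ?invr_gt0// invrK lnK.
(* This is where [nu < 1 / e] enters. *)
have L1 : 1 <= L.
  by rewrite -lerN2 -ler_expR nuL expRN ltW.
have [B1 [mB1 PB1 nB1]] := noise_vector_tail s0 L1 p0 iid.
have [B2 [mB2 PB2 nB2]] := noise_matrix_tail s0 L1 p0 iid.
have mB : measurable (B1 `|` B2) by exact: measurableU.
exists (~` (B1 `|` B2)); split; first exact: measurableC.
- move=> t /not_orP[/nB1 nt /nB2 Nt].
  set tau := sigma * Num.sqrt p%:R * L in sM nt Nt.
  have tau0 : 0 < tau.
    by rewrite !mulr_gt0 ?sqrtr_gt0 ?ltr0n// (lt_le_trans _ L1).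
  have s_tau : 720 * tau <= eta * sigma_min (X^T *m X).
    apply: le_trans (_ : eta * (2 * 360 / eta * tau) <= _).
      by rewrite le_eqVlt; apply/orP; left; apply/eqP; field; rewrite gt_eqF.
    by rewrite ler_pM2l.
  set M := X^T *m X in s_tau Mu *; set S := sigma_min M in s_tau.
  have S0 : 0 < S by rewrite -(pmulr_rgt0 _ eta0); lra.
  have eS : eta * S <= S by rewrite ler_piMl// ltW.
  have tS : 18 * tau < S by lra.
  have [Au q] := solution_perturb (X^T *m y) (\col_i nf i t) Mu tS Nt.
  split=> //; move: q; rewrite -/beta_hat -/S.
  have := vnorm_ge0 beta_hat; set b := vnorm beta_hat => b0.
  rewrite -[invmx _ *m _ - _]/(beta_t t - beta_hat).
  have := vnorm_ge0 (beta_t t - beta_hat); set x := vnorm (_ - _) => x0 H.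
  (* As [18 * tau <= eta * S / 40], at least [39 / 40 * S] remains of [S - 18 * tau]. The vector
     term then fits exactly: [39 / 20 * tau <= 39 / 20 * (eta * S / 720) = 39 / 40 * S * (eta /
     360)]. *)
  rewrite -(@ler_pM2l _ (39 / 40 * S)) ?mulr_gt0//.
  have : 39 / 40 * S * x <= (S - 18 * tau) * x by rewrite ler_wpM2r//; lra.
  have : tau * b <= eta * S / 720 * b by rewrite ler_wpM2r//; lra.
  have : 0 <= eta * S * b by rewrite !mulr_ge0// ltW.
  lra.
- rewrite probability_setC//.
  have PB : (P (B1 `|` B2) <= nu%:E)%E.
    apply: le_trans (measureU2 _ mB1 mB2) _.
    rewrite (_ : nu = 9 / 10 * expR (- L) + 10^-1 * expR (- L)).
      by rewrite EFinD leeD.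
    by rewrite nuL; field.
  by rewrite EFinB leeB.
Qed.
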